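(* Let $\mathbf k=(k_1,\dots,k_q)$ be a rank profile of positive integers and suppose that the smoothness assumption holds at $\mathbf k$: if $\mathcal M_{\mathbf k}\neq\varnothing$, there is an open neighborhood $\mathcal U_{\mathbf k}\supset\mathcal M_{\mathbf k}$ on which $F\mapsto Dc(F)$ has constant rank. Suppose also that for every $c\in[q]$, $$k_c\ge n_c\qquad\text{or}\qquad \tau(k_c)>r_c .$$ Then, for (Lebesgue-)almost every $C=(C_1,\dots,C_q)\in\prod_{c=1}^q\mathbb S^{n_c}$, every second-order critical point $F$ of the fixed-rank Burer--Monteiro problem at profile $\mathbf k$ is globally optimal for the product SDP, i.e. the tuple $(F_cF_c^\top)_{c=1}^q$ is an optimal solution of $$\min_{\{X_c\succeq0\}}\ \sum_{c=1}^q\langle C_c,X_c\rangle\quad\text{s.t.}\quad \sum_{c=1}^q\mathcal A_c(X_c)=b .$$ If $k_c\ge n_c$ for every block $c\in[q]$, the conclusion holds for every $C\in\prod_c\mathbb S^{n_c}$.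
   Context: Let $q,m,n_1,\dots,n_q$ be positive integers, $[q]=\{1,\dots,q\}$, and $\mathbb S^n$ the real symmetric $n\times n$ matrices with inner product $\langle A,B\rangle=\operatorname{tr}(A^\top B)$. Fix $b\in\mathbb R^m$ and linear maps $\mathcal A_c:\mathbb S^{n_c}\to\mathbb R^m$ with adjoints $\mathcal A_c^*$ (redundant affine rows are allowed). Define $r_c:=\operatorname{rank}(\mathcal A_c)$ and $\tau(k):=k(k+1)/2$. Factors: $F=(F_1,\dots,F_q)$ with $F_c\in\mathbb R^{n_c\times k_c}$; the direct-sum factor space has inner product $\sum_c\langle F_c,U_c\rangle$. Set $c(F):=\sum_c\mathcal A_c(F_cF_c^\top)-b$ and $\mathcal M_{\mathbf k}:=\{F:c(F)=0\}$. The derivative is $Dc(F)[U]=\sum_c\mathcal A_c(F_cU_c^\top+U_cF_c^\top)$. The fixed-rank Burer--Monteiro problem at profile $\mathbf k$ is $\min_F g(F):=\sum_c\langle C_c,F_cF_c^\top\rangle$ subject to $c(F)=0$. Let $\mathcal B_F\nu:=(\mathcal A_c^*(\nu)F_c)_{c=1}^q$ for $\nu\in\mathbb R^m$, $G(F):=\mathcal B_F^*\mathcal B_F$, $C_F:=(C_cF_c)_{c=1}^q$, and, with $\dagger$ the Moore--Penrose pseudoinverse, $\mu_B(F):=G(F)^\dagger\mathcal B_F^*C_F$, $S_{B,c}(F):=C_c-\mathcal A_c^*(\mu_B(F))$. A factor $F\in\mathcal M_{\mathbf k}$ is a second-order critical point of the fixed-rank problem if $S_{B,c}(F)F_c=0$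 for all $c\in[q]$ and $\sum_c\langle U_c,S_{B,c}(F)U_c\rangle\ge0$ for every $U\in\ker Dc(F)$. *)

(* Defs.v *)
From HB Require Import structures.
From mathcomp Require Import all_boot all_order all_algebra.
From mathcomp Require Import all_classical all_reals all_analysis.

Set Implicit Arguments.
Unset Strict Implicit.
Unset Printing Implicit Defensive.

Import Order.TTheory GRing.Theory Num.Theory VectorInternalTheory.
Import numFieldNormedType.Exports.

Local Open Scope classical_set_scope.
Local Open Scope ring_scope.

HB.mixin Record isEuclidean (R : realType) V of Vector R V := {
  inner : V -> V -> R ;
  innerC : forall u v, inner u v = inner v u ;
  innerPl : forall a u v w, inner (a *: u + v) w = a * inner u w + inner v w ;
  inner_gt0 : forall u, u != 0 -> 0 < inner u u
}.

#[short(type="euclideanType")]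
HB.structure Definition Euclidean (R : realType) :=
  { V of Vector R V & isEuclidean R V }.

Notation "''[' u , v ]" := (inner u v) (format "''[' u ,  v ]") : ring_scope.

Section InnerTheory.
Variables (R : realType) (V : euclideanType R).
Implicit Types u v w : V.

Lemma innerPr a u v w : '[w, a *: u + v] = a * '[w, u] + '[w, v].
Proof. by rewrite innerC innerPl !(innerC w). Qed.

Lemma inner0l v : '[0, v] = 0.
Proof.
have := innerPl 1 (0 : V) 0 v; rewrite scaler0 addr0 mul1r => /eqP.
by rewrite -subr_eq0 opprD addrA subrr sub0r oppr_eq0 => /eqP.
Qed.

Lemma innerDl u v w : '[u + v, w] = '[u, w] + '[v, w].
Proof. by rewrite -[u]scale1r innerPl scale1r mul1r. Qed.

Lemma innerZl a u w : '[a *: u, w] = a * '[u, w].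
Proof. by rewrite -[a *: u]addr0 innerPl inner0l addr0. Qed.

Lemma innerBl u v w : '[u - v, w] = '[u, w] - '[v, w].
Proof. by rewrite innerDl -scaleN1r innerZl mulN1r. Qed.

Lemma inner_suml I (r : seq I) (P : pred I) (F : I -> V) w :
  '[\sum_(i <- r | P i) F i, w] = \sum_(i <- r | P i) '[F i, w].
Proof.
elim/big_rec2: _ => [|i x y _ <-]; [exact: inner0l | exact: innerDl].
Qed.

Lemma inner_eq0 u : '[u, u] = 0 -> u = 0.
Proof.
by move=> u0; apply/eqP; apply: contraT => /inner_gt0; rewrite u0 ltxx.
Qed.

Lemma inner_inj u v : (forall w, '[u, w] = '[v, w]) -> u = v.
Proof.
move=> h; apply/eqP; rewrite -subr_eq0; apply/eqP/inner_eq0.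
by rewrite innerBl h subrr.
Qed.

End InnerTheory.

Section MatrixInner.
Variables (R : realType) (m n : nat).

Definition mxinner (A B : 'M[R]_(m, n)) : R := \tr (A^T *m B).

Lemma mxinnerE A B : mxinner A B = \sum_j \sum_i A i j * B i j.
Proof.
by apply: eq_bigr => j _; rewrite mxE; apply: eq_bigr => i _; rewrite mxE.
Qed.

Fact mxinnerC A B : mxinner A B = mxinner B A.
Proof.
by rewrite !mxinnerE; do 2![apply: eq_bigr => ? _]; rewrite mulrC.
Qed.

Fact mxinnerPl a A B C :
  mxinner (a *: A + B) C = a * mxinner A C + mxinner B C.
Proof. by rewrite /mxinner linearP mulmxDl -scalemxAl linearP. Qed.

Fact mxinner_gt0 A : A != 0 -> 0 < mxinner A A.
Proof.
have s0 j : 0 <= \sum_i A i j * A i j.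
  by apply: sumr_ge0 => i _; rewrite -expr2 sqr_ge0.
have ge0 : 0 <= mxinner A A by rewrite mxinnerE sumr_ge0.
rewrite lt_def ge0 andbT; apply: contraNneq => /eqP.
rewrite mxinnerE psumr_eq0 // => /allP h.
apply/eqP/matrixP => i j; rewrite mxE.
have := h j (mem_index_enum j); rewrite /= psumr_eq0 => [/allP/(_ i)|? _].
  by rewrite mem_index_enum mulf_eq0 orbb => /(_ isT)/eqP.
by rewrite -expr2 sqr_ge0.
Qed.

HB.instance Definition _ :=
  isEuclidean.Build R 'M[R]_(m, n) mxinnerC mxinnerPl mxinner_gt0.

End MatrixInner.

Section SubspaceInner.
Variables (R : realType) (V : euclideanType R) (U : {vspace V}).

Definition subinner (x y : subvs_of U) : R := '[vsval x, vsval y].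

Fact subinnerC x y : subinner x y = subinner y x.
Proof. exact: innerC. Qed.

Fact subinnerPl a x y z :
  subinner (a *: x + y) z = a * subinner x z + subinner y z.
Proof. by rewrite /subinner linearP innerPl. Qed.

Fact subinner_gt0 x : x != 0 -> 0 < subinner x x.
Proof. by move=> x0; apply: inner_gt0; rewrite -[0]/(vsval (0 : subvs_of U)) (inj_eq val_inj). Qed.

HB.instance Definition _ :=
  isEuclidean.Build R (subvs_of U) subinnerC subinnerPl subinner_gt0.

End SubspaceInner.

(* The orthogonal direct sum of a finite family of spaces, as dependent
   functions. *)
Definition dsum (R : realType) (q : nat) (V : 'I_q -> euclideanType R) : Type :=
  forall c, V c.

Section DirectSum.
Variables (R : realType) (q : nat) (V : 'I_q -> euclideanType R).
Implicit Types f g h : dsum V.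

HB.instance Definition _ := gen_eqMixin (dsum V).
HB.instance Definition _ := gen_choiceMixin (dsum V).

Let add f g : dsum V := fun c => f c + g c.
Let opp f : dsum V := fun c => - f c.
Let zero : dsum V := fun c => 0.
Let scale (a : R) f : dsum V := fun c => a *: f c.

Fact dsum_addA : associative add.
Proof. by move=> f g h; apply: functional_extensionality_dep => c; apply: addrA. Qed.
Fact dsum_addC : commutative add.
Proof. by move=> f g; apply: functional_extensionality_dep => c; apply: addrC. Qed.
Fact dsum_add0 : left_id zero add.
Proof. by move=> f; apply: functional_extensionality_dep => c; apply: add0r. Qed.
Fact dsum_addN : left_inverse zero opp add.
Proof. by move=> f; apply: functional_extensionality_dep => c; apply: addNr. Qed.

HB.instance Definition _ :=
  GRing.isZmodule.Build (dsum V) dsum_addA dsum_addC dsum_add0 dsum_addN.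

Fact dsum_scaleA a b f : scale a (scale b f) = scale (a * b) f.
Proof. by apply: functional_extensionality_dep => c; apply: scalerA. Qed.
Fact dsum_scale1 : left_id 1 scale.
Proof. by move=> f; apply: functional_extensionality_dep => c; apply: scale1r. Qed.
Fact dsum_scaleDr : right_distributive scale +%R.
Proof. by move=> a f g; apply: functional_extensionality_dep => c; apply: scalerDr. Qed.
Fact dsum_scaleDl f : {morph scale^~ f : a b / a + b}.
Proof. by move=> a b; apply: functional_extensionality_dep => c; apply: scalerDl. Qed.

HB.instance Definition _ := GRing.Zmodule_isLmodule.Build R (dsum V)
  dsum_scaleA dsum_scale1 dsum_scaleDr dsum_scaleDl.

Lemma dsumDE f g c : (f + g) c = f c + g c. Proof. by []. Qed.
Lemma dsumZE a f c : (a *: f) c = a *: f c. Proof. by []. Qed.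
Lemma dsum0E c : (0 : dsum V) c = 0. Proof. by []. Qed.

Let coords f : 'rV[R]_(\sum_c dim (V c)) := \mxrow_c v2r (f c).

Fact dsum_vect_axiom : Vector.axiom (\sum_c dim (V c)) (dsum V).
Proof.
exists coords.
  move=> a f g; rewrite /coords; apply/(mxrowP _ _).1 => c.
  have E h : submxrow (\mxrow_c0 v2r (h c0)) c = v2r (h c) by exact: mxrowK.
  rewrite E dsumDE dsumZE linearP /= -(E f) -(E g).
  by apply/rowP => i; rewrite !mxE.
pose decoords (x : 'rV[R]_(\sum_c dim (V c))) : dsum V :=
  fun c => r2v (submxrow x c).
exists decoords => [f|x].
  apply: functional_extensionality_dep => c.
  by rewrite /decoords /coords mxrowK v2rK.
rewrite /coords -[RHS](@submxrowK _ _ (fun c => dim (V c))); apply: eq_mxrow => c.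
exact: r2vK.
Qed.

HB.instance Definition _ := Lmodule_hasFinDim.Build R (dsum V) dsum_vect_axiom.

Definition dsum_inner f g : R := \sum_c '[f c, g c].

Fact dsum_innerC f g : dsum_inner f g = dsum_inner g f.
Proof. by apply: eq_bigr => c _; apply: innerC. Qed.

Fact dsum_innerPl a f g h :
  dsum_inner (a *: f + g) h = a * dsum_inner f h + dsum_inner g h.
Proof.
rewrite /dsum_inner mulr_sumr -big_split /=; apply: eq_bigr => c _.
exact: innerPl.
Qed.

Fact dsum_inner_gt0 f : f != 0 -> 0 < dsum_inner f f.
Proof.
have p0 c : 0 <= '[f c, f c].
  by have [->|/inner_gt0/ltW//] := eqVneq (f c) 0; rewrite inner0l.
rewrite lt_def sumr_ge0 // andbT; apply: contraNneq => /eqP.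
rewrite psumr_eq0 // => /allP h; apply/eqP.
apply: functional_extensionality_dep => c; apply: inner_eq0.
exact/eqP/(implyP (h c (mem_index_enum c))).
Qed.

HB.instance Definition _ :=
  isEuclidean.Build R (dsum V) dsum_innerC dsum_innerPl dsum_inner_gt0.

End DirectSum.

Section Adjoint.
Variables (R : realType) (V W : euclideanType R).

(* adjoint and pinvlf below are picked by their defining properties; existence
   and uniqueness are adjointP, is_adjoint_uniq, pinvlfP and is_pinv_uniq. *)
Definition is_adjoint (f : 'Hom(V, W)) (g : 'Hom(W, V)) : Prop :=
  forall v w, '[f v, w] = '[v, g w].

Definition adjoint (f : 'Hom(V, W)) : 'Hom(W, V) :=
  xget 0 [set g | is_adjoint f g].

Lemma is_adjoint_uniq f g h : is_adjoint f g -> is_adjoint f h -> g = h.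
Proof.
move=> fg fh; apply/lfunP => w; apply: inner_inj => v.
by rewrite !(innerC _ v) -fg fh.
Qed.

Let b := vbasis {:V}.

Let phi (U : euclideanType R) (e : (\dim {:V}).-tuple U) (u : U) :
  'rV[R]_(\dim {:V}) := \row_i '[u, tnth e i].

Let phi_linear U e : linear (@phi U e).
Proof. by move=> a u v; apply/rowP => i; rewrite !mxE innerPl. Qed.

Let is_adjoint_ex f : exists g, is_adjoint f g.
Proof.
pose pV : {linear V -> _} := HB.pack (phi b)
  (GRing.isLinear.Build R _ _ _ (phi b) (phi_linear b)).
pose fb := map_tuple f b.
pose pW : {linear W -> _} := HB.pack (phi fb)
  (GRing.isLinear.Build R _ _ _ (phi fb) (phi_linear fb)).
pose T := linfun pV.
have span_eq v v' : phi b v = phi b v' -> v = v'.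
  move=> e; apply: inner_inj => w.
  rewrite !(innerC _ w) (coord_vbasis (memvf w)) !inner_suml.
  apply: eq_bigr => i _; rewrite !innerZl; congr (_ * _).
  have /rowP/(_ i) := e; rewrite !mxE (tnth_nth 0) => h.
  by rewrite !(innerC b`_i).
have kT : lker T == 0%VS.
  by apply/lker0P => v v'; rewrite !lfunE; apply: span_eq.
have T_surj x : x \in limg T.
  suff -> : limg T = fullv by apply: memvf.
  apply/eqP; rewrite eqEdim subvf /= dimvf /dim /= mul1n.
  by rewrite limg_dim_eq // (eqP kT) capv0.
exists (T^-1 \o linfun pW)%VF => v w.
have : T ((T^-1 \o linfun pW)%VF w) = pW w.
  by rewrite comp_lfunE limg_lfunVK // lfunE.
rewrite lfunE /=; set g := ((_ \o _)%VF w) => /rowP h.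
rewrite (coord_vbasis (memvf v)) linear_sum !inner_suml.
apply: eq_bigr => i _; rewrite linearZ /= !innerZl; congr (_ * _).
by have := h i; rewrite !mxE tnth_map (tnth_nth 0) !(innerC _ w) innerC => ->.
Qed.

Lemma adjointP (f : 'Hom(V, W)) v w : '[f v, w] = '[v, adjoint f w].
Proof. by have [g fg] := is_adjoint_ex f; apply: (xgetPex 0 (ex_intro _ g fg)). Qed.

Lemma adjoint_eq (f : 'Hom(V, W)) g : is_adjoint f g -> adjoint f = g.
Proof. exact/is_adjoint_uniq/adjointP. Qed.

End Adjoint.

Section AdjointTheory.
Variables (R : realType) (U V W : euclideanType R).

Lemma adjointK (f : 'Hom(V, W)) : adjoint (adjoint f) = f.
Proof. by apply: adjoint_eq => w v; rewrite innerC -adjointP innerC. Qed.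

Lemma adjoint_comp (f : 'Hom(V, W)) (g : 'Hom(U, V)) :
  adjoint (f \o g)%VF = (adjoint g \o adjoint f)%VF.
Proof. by apply: adjoint_eq => u w; rewrite !comp_lfunE !adjointP. Qed.

End AdjointTheory.

Section MoorePenrose.
Variables (R : realType) (V W : euclideanType R).
Local Open Scope lfun_scope.

Definition is_pinv (f : 'Hom(V, W)) (p : 'Hom(W, V)) : Prop :=
  [/\ f \o p \o f = f, p \o f \o p = p,
      adjoint (f \o p) = f \o p & adjoint (p \o f) = p \o f].

Definition pinvlf (f : 'Hom(V, W)) : 'Hom(W, V) := xget 0 [set p | is_pinv f p].

Lemma is_pinv_uniq f p r : is_pinv f p -> is_pinv f r -> p = r.
Proof.
move=> [p1 p2 p3 p4] [r1 r2 r3 r4].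
have fpr : f \o p = f \o r.
  by rewrite -p3 -{1}r1 -(comp_lfunA _ f) adjoint_comp p3 r3 comp_lfunA p1.
have pfr : p \o f = r \o f.
  rewrite -p4 -{1}r1 -comp_lfunA comp_lfunA adjoint_comp p4 r4.
  by rewrite -comp_lfunA (comp_lfunA f) p1.
by rewrite -p2 pfr -comp_lfunA fpr comp_lfunA r2.
Qed.

End MoorePenrose.

Section MoorePenroseExistence.
Variable R : realType.
Local Open Scope lfun_scope.

Let incl (V : euclideanType R) (U : {vspace V}) : 'Hom(subvs_of U, V) :=
  linfun vsval.

Let incl_adjK (V : euclideanType R) (U : {vspace V}) :
  adjoint (incl U) \o incl U = \1.
Proof.
apply/lfunP => x; rewrite comp_lfunE id_lfunE; apply: inner_inj => y.
by rewrite innerC -adjointP !lfunE innerC.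
Qed.

Let incl_fix (V : euclideanType R) (U : {vspace V}) v :
  v \in U -> incl U (adjoint (incl U) v) = v.
Proof.
move=> vU; have {1}-> : v = incl U (Subvs vU) by rewrite lfunE.
by rewrite -[adjoint _ _]comp_lfunE incl_adjK id_lfunE lfunE.
Qed.

Let incl_comp (V W : euclideanType R) (f : 'Hom(V, W)) :
  incl (limg f) \o adjoint (incl (limg f)) \o f = f.
Proof.
by apply/lfunP => v; rewrite !comp_lfunE incl_fix // memv_img // memvf.
Qed.

Let compress (V W : euclideanType R) (f : 'Hom(V, W)) :
    'Hom(subvs_of (limg (adjoint f)), subvs_of (limg f)) :=
  adjoint (incl (limg f)) \o f \o incl (limg (adjoint f)).

Let compress_inj (V W : euclideanType R) (f : 'Hom(V, W)) :
  lker (compress f) == 0%VS.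
Proof.
apply/eqP/vspaceP => x; rewrite memv_ker memv0; apply/eqP/eqP => [|->]; last first.
  by rewrite linear0.
rewrite !comp_lfunE => /(congr1 (incl (limg f))).
rewrite linear0 incl_fix ?memv_img ?memvf // !lfunE /= => fx0.
have /memv_imgP[y _ xy] := subvsP x.
apply: val_inj; change (vsval x = 0); apply: inner_eq0.
by rewrite {2}xy -adjointP fx0 inner0l.
Qed.

Let limg_compress (V W : euclideanType R) (f : 'Hom(V, W)) :
  \dim (limg (compress f)) = \dim (limg (adjoint f)).
Proof. by rewrite limg_dim_eq ?(eqP (compress_inj f)) ?capv0 // dimvf. Qed.

Let dim_adjoint (V W : euclideanType R) (f : 'Hom(V, W)) :
  (\dim (limg (adjoint f)) <= \dim (limg f))%N.
Proof.
rewrite -limg_compress.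
by have := dimvS (subvf (limg (compress f))); rewrite [X in (_ <= X)%N]dimvf.
Qed.

Lemma pinvlfP (V W : euclideanType R) (f : 'Hom(V, W)) : is_pinv f (pinvlf f).
Proof.
suff [p fp] : exists p, is_pinv f p by apply: (xgetPex 0 (ex_intro _ p fp)).
set iM := incl (limg (adjoint f)); set iL := incl (limg f).
set h := compress f.
have h_surj y : y \in limg h.
  suff -> : limg h = fullv by apply: memvf.
  apply/eqP; rewrite eqEdim subvf limg_compress [X in (X <= _)%N]dimvf.
  by have := dim_adjoint (adjoint f); rewrite adjointK.
have fL v : iL (adjoint iL (f v)) = f v.
  by rewrite incl_fix // memv_img // memvf.
have fM v : f (iM (adjoint iM v)) = f v.
  have /(congr1 (@adjoint _ _ _)) := incl_comp (adjoint f).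
  rewrite !adjoint_comp !adjointK => /lfunP/(_ v).
  by rewrite !comp_lfunE.
have iMK x : adjoint iM (iM x) = x.
  by have /lfunP/(_ x) := incl_adjK (limg (adjoint f)); rewrite comp_lfunE id_lfunE.
have iLK x : adjoint iL (iL x) = x.
  by have /lfunP/(_ x) := incl_adjK (limg f); rewrite comp_lfunE id_lfunE.
have hE x : h x = adjoint iL (f (iM x)) by rewrite !comp_lfunE.
pose p := iM \o h^-1 \o adjoint iL.
have pE w : p w = iM (h^-1 (adjoint iL w)) by rewrite !comp_lfunE.
have hK x : h^-1 (h x) = x by apply: lker0_lfunK; apply: compress_inj.
have fpE : f \o p = iL \o adjoint iL.
  apply/lfunP => w; rewrite comp_lfunE pE comp_lfunE -[f _]fL -hE.
  by rewrite limg_lfunVK.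
have pfE : p \o f = iM \o adjoint iM.
  by apply/lfunP => v; rewrite comp_lfunE pE -[f v]fM -hE hK comp_lfunE.
exists p; split.
- by apply/lfunP => v; rewrite fpE !comp_lfunE fL.
- by apply/lfunP => w; rewrite pfE 2!comp_lfunE pE iMK.
- by rewrite fpE adjoint_comp adjointK.
- by rewrite pfE adjoint_comp adjointK.
Qed.

End MoorePenroseExistence.

(* Countable covers by closed boxes of arbitrarily small total volume, in the
   coordinates of a basis of V; an invertible linear change of coordinates
   preserves null sets, so the choice of the basis is immaterial. *)
Definition lebesgue_null (R : realType) (V : euclideanType R) (N : set V) :
    Prop :=
  let x (v : V) (i : 'I_(\dim {:V})) := coord (vbasis {:V}) i v in
  forall eps : R, 0 < eps ->
  exists lo hi : nat -> 'I_(\dim {:V}) -> R,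
    [/\ forall j i, lo j i <= hi j i,
        N `<=` \bigcup_j [set v | forall i, lo j i <= x v i <= hi j i] &
        (\sum_(0 <= j <oo) (\prod_i (hi j i - lo j i))%:E <= eps%:E)%E].

Definition almost_every (R : realType) (V : euclideanType R) (P : V -> Prop) :
    Prop :=
  lebesgue_null [set v | ~ P v].

Definition symv (R : realType) (n : nat) : {vspace 'M[R]_n} :=
  fixedSpace (linfun (@trmx R n n)).

Lemma symvE (R : realType) n (X : 'M[R]_n) : (X \in symv R n) = (X^T == X).
Proof. by apply/fixedSpaceP/eqP; rewrite lfunE. Qed.

Notation "''Sym[' R ]_ n" := (subvs_of (symv R n))
  (at level 8, n at level 2, format "''Sym[' R ]_ n") : type_scope.

(* vsproj is some linear projection onto symv; every matrix to which it is
   applied below is already symmetric, and there vsval (tosym X) = X. *)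
Definition tosym (R : realType) (n : nat) (X : 'M[R]_n) : 'Sym[R]_n :=
  vsproj (symv R n) X.

Lemma tosymK (R : realType) n (X : 'M[R]_n) : X^T = X -> vsval (tosym X) = X.
Proof. by move=> Xs; rewrite vsprojK // symvE Xs. Qed.

Lemma gram_sym (R : realType) n k (F : 'M[R]_(n, k)) :
  vsval (tosym (F *m F^T)) = F *m F^T.
Proof. by apply: tosymK; rewrite trmx_mul trmxK. Qed.

Lemma gram2_sym (R : realType) n k (F U : 'M[R]_(n, k)) :
  vsval (tosym (F *m U^T + U *m F^T)) = F *m U^T + U *m F^T.
Proof. by apply: tosymK; rewrite linearD /= !trmx_mul !trmxK addrC. Qed.

Definition psd (R : realType) (n : nat) (X : 'Sym[R]_n) : Prop :=
  forall x : 'cV[R]_n, 0 <= '[x, vsval X *m x].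

Definition tau (k : nat) : nat := (k * k.+1)./2.

Section BurerMonteiro.
Variables (R : realType) (q m : nat) (n : 'I_q -> nat).

Definition symspace := dsum (fun c => 'Sym[R]_(n c)).

Variables (A : forall c, 'Hom('Sym[R]_(n c), 'cV[R]_m)) (b : 'cV[R]_m).

Definition oprank c : nat := \dim (limg (A c)).

Definition sdp_feasible (X : symspace) : Prop :=
  (forall c, psd (X c)) /\ \sum_c A c (X c) = b.

Definition sdp_optimal (C X : symspace) : Prop :=
  sdp_feasible X /\
  forall Y, sdp_feasible Y -> \sum_c '[C c, X c] <= \sum_c '[C c, Y c].

Variable k : 'I_q -> nat.

Definition factor_space := dsum (fun c => 'M[R]_(n c, k c)).

Implicit Types F U : factor_space.

Definition gram F : symspace := fun c => tosym (F c *m (F c)^T).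

Definition constr F : 'cV[R]_m := \sum_c A c (gram F c) - b.

Definition bm_feasible : set factor_space := [set F | constr F = 0].

Definition dconstr_fun F U : 'cV[R]_m :=
  \sum_c A c (tosym (F c *m (U c)^T + U c *m (F c)^T)).

Fact dconstr_linear F : linear (dconstr_fun F).
Proof.
move=> a U1 U2; rewrite /dconstr_fun scaler_sumr -big_split /=.
apply: eq_bigr => c _; rewrite /tosym -linearP -linearP /=.
congr (A c (vsproj _ _)).
rewrite dsumDE dsumZE linearP /= mulmxDr mulmxDl -scalemxAr -scalemxAl.
by rewrite scalerDr addrACA.
Qed.

HB.instance Definition _ F :=
  GRing.isLinear.Build R factor_space 'cV[R]_m _ (dconstr_fun F) (dconstr_linear F).

Definition dconstr F : 'Hom(factor_space, 'cV[R]_m) := linfun (dconstr_fun F).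

Lemma dconstrE F U :
  dconstr F U = \sum_c A c (tosym (F c *m (U c)^T + U c *m (F c)^T)).
Proof. exact: lfunE. Qed.

Definition smooth_at : Prop :=
  bm_feasible !=set0 ->
  exists W : set (prod_topology (fun c => 'M[R]_(n c, k c))),
    [/\ open W, bm_feasible `<=` W &
        exists r : nat, forall F, W F -> \dim (limg (dconstr F)) = r].

Definition symmul (S : symspace) F : factor_space := fun c => vsval (S c) *m F c.

Definition adjA (nu : 'cV[R]_m) : symspace := fun c => adjoint (A c) nu.

Definition bmul_fun F (nu : 'cV[R]_m) : factor_space := symmul (adjA nu) F.

Fact bmul_linear F : linear (bmul_fun F).
Proof.
move=> a x y; apply: functional_extensionality_dep => c.
by rewrite /bmul_fun /symmul /adjA linearP linearP mulmxDl -scalemxAl.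
Qed.

HB.instance Definition _ F :=
  GRing.isLinear.Build R 'cV[R]_m factor_space _ (bmul_fun F) (bmul_linear F).

Definition bmul F : 'Hom('cV[R]_m, factor_space) := linfun (bmul_fun F).

Lemma bmulE F nu c : bmul F nu c = vsval (adjoint (A c) nu) *m F c.
Proof. by rewrite lfunE. Qed.

Definition bgram F : 'End('cV[R]_m) := (adjoint (bmul F) \o bmul F)%VF.

Definition multiplier (C : symspace) F : 'cV[R]_m :=
  pinvlf (bgram F) (adjoint (bmul F) (symmul C F)).

Definition slack (C : symspace) F : symspace := C - adjA (multiplier C F).

Definition second_order_critical (C : symspace) F : Prop :=
  [/\ bm_feasible F,
      forall c, vsval (slack C F c) *m F c = 0 &
      forall U, dconstr F U = 0 ->
        0 <= \sum_c '[U c, vsval (slack C F c) *m U c]].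

End BurerMonteiro.

(* Main.v *)
From HB Require Import structures.
Require Import Defs.
From mathcomp Require Import all_boot all_order all_fingroup all_algebra.
From mathcomp Require Import all_classical all_reals all_analysis.
From mathcomp Require Import ring lra zify.

Local Open Scope ring_scope.

Set Implicit Arguments.
Unset Strict Implicit.
Unset Printing Implicit Defensive.

Import Order.TTheory GRing.Theory Num.Theory VectorInternalTheory.

(** Let [F] be second-order critical for [C], with multiplier [mu] and slack
    [S = C - A^*(mu)], so that [S F = 0] blockwise.

    If every block of [S] is positive semidefinite, [F] is globally optimal:
    for any feasible [X], [sum <C, X> = sum <S, X> + <b, mu>], where
    [sum <S, X>] is nonnegative ([psd_inner_ge0]) and vanishes at [X = F F^T]
    ([psd_slack_optimal]).

    If [F c] has a nonzero kernel vector [z], the directions [x z^T] placed in block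
    [c] are tangent to the constraint, and along them the second-order
    condition is the positivity of [x^T S_c x]
    ([rank_deficient_psd_slack]). If [F c] has full column rank [k c] and
    [n c <= k c], then [F c] is invertible and [S_c = 0]
    ([wide_psd_slack]). This settles every cost when all blocks are wide.

    What remains is a block with [k c < n c] where [F c] has full column rank.
    Then [C c = S_c + A_c^*(mu)] with [S_c] killed by a matrix of rank [k c].
    Such an [S_c] is [J^T d J] for a symmetric [d] of order [n c - k c] and a
    matrix [J] which, up to a permutation of the columns, is [(Z | I)]. So
    [C c] lies in the image of finitely many polynomial maps of
    [tau(n c - k c) + k c (n c - k c) + r_c = tau(n c) - tau(k c) + r_c]
    parameters, which is less than [tau(n c)] ([low_rank_param]). Adding the
    coordinates of the other blocks as free parameters, the exceptional costs
    lie in a finite union of images of locally Lipschitz maps from spaces of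
    smaller dimension, and such images are null ([lebesgue_null_image]): a
    ball of a [d]-dimensional space is cut into about [M^d] cubes of side
    [1/M], whose images fit in boxes of total volume
    [O(M^d M^(-D)) = O(1/M)]. *)

(** * Null sets *)

Section NullSets.
Local Open Scope classical_set_scope.
Variables (R : realType) (V : euclideanType R).
Hypothesis dimV : (0 < dim V)%N.

Let D := \dim {:V}.
Let x (v : V) (i : 'I_D) := coord (vbasis {:V}) i v.

Lemma lebesgue_null_sub (N N' : set V) :
  N `<=` N' -> lebesgue_null N' -> lebesgue_null N.
Proof.
move=> sub null ? eps eps_gt0; have [lo [hi [le_lohi cov vol]]] := null eps eps_gt0.
by exists lo, hi; split => //; apply: (subset_trans sub).
Qed.

(** Frees covers from being indexed by [nat]. The indices outside
    the range of [pickle] get one-point boxes, whose volume is zero only because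
    the dimension is positive. *)
Lemma lebesgue_null_cover (N : set V) :
  (forall eps : R, 0 < eps -> exists (T : countType) (lo hi : T -> 'I_D -> R),
    [/\ forall t i, lo t i <= hi t i,
        N `<=` \bigcup_t [set v | forall i, lo t i <= x v i <= hi t i] &
        (\esum_(t in [set: T]) (\prod_i (hi t i - lo t i))%:E <= eps%:E)%E]) ->
  lebesgue_null N.
Proof.
move=> cov ? eps /cov[T [lo [hi [le_lohi sub vol]]]].
pose ext (b : T -> 'I_D -> R) j := oapp b (fun=> 0) (pickle_inv j).
exists (ext lo), (ext hi); split=> [j i|v /sub[t _ vt]|].
- by rewrite /ext; case: pickle_inv => /=.
- by exists (pickle t) => // i; rewrite /ext pickleK_inv /=; apply: vt.
have pos t : 0 <= \prod_i (hi t i - lo t i).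
  by apply: prodr_ge0 => i _; rewrite subr_ge0.
rewrite nneseries_esumT => [|j]; last first.
  rewrite lee_fin /ext; case: pickle_inv => [t|] //=.
  by apply: prodr_ge0 => i _; rewrite subrr.
apply: le_trans vol.
have -> : (\esum_(t in [set: T]) (\prod_i (hi t i - lo t i))%:E =
    \esum_(j in pickle @` [set: T]) (\prod_i (ext hi j i - ext lo j i))%:E)%E.
  rewrite esum_image => [|s t _ _]; last exact: (pcan_inj pickleK).
  by apply: eq_esum => t _; rewrite /ext pickleK_inv.
rewrite [leRHS]esum_mkcond; apply: le_esum => j _; case: ifPn => // nj.
rewrite /ext; case e: (pickle_inv j) => [t|] /=; last first.
  rewrite (eq_bigr (fun=> 0)) => [|i _]; last by rewrite subrr.
  by rewrite prodr_const card_ord expr0n /D dimvf eqn0Ngt dimV.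
case/negP: nj; rewrite inE /=; exists t => //.
by have := @pickle_invK T j; rewrite e.
Qed.

Lemma lebesgue_null_bigcup (T : countType) (N : T -> set V) :
  (forall t, lebesgue_null (N t)) -> lebesgue_null (\bigcup_t N t).
Proof.
move=> null; apply: lebesgue_null_cover => eps eps_gt0.
pose e (t : T) : R := eps / (2 ^ (pickle t).+1)%:R.
have e_gt0 t : 0 < e t by rewrite divr_gt0 // ltr0n expn_gt0.
have /choice[B covB] t : exists b : (nat -> 'I_D -> R) * (nat -> 'I_D -> R),
    [/\ forall j i, b.1 j i <= b.2 j i,
        N t `<=` \bigcup_j [set v | forall i, b.1 j i <= x v i <= b.2 j i] &
        (\sum_(0 <= j <oo) (\prod_i (b.2 j i - b.1 j i))%:E <= (e t)%:E)%E].
  by have [lo [hi h]] := null t (e t) (e_gt0 t); exists (lo, hi).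
exists (T * nat)%type, (fun p => (B p.1).1 p.2), (fun p => (B p.1).2 p.2).
split=> [[t j] i|v [t _ Nv]|] /=.
- by have [] := covB t.
- by have [_ /(_ v Nv)[j _ vj] _] := covB t; exists (t, j).
have pos t j : (0 <= (\prod_i ((B t).2 j i - (B t).1 j i))%:E)%E.
  rewrite lee_fin; apply: prodr_ge0 => i _; rewrite subr_ge0.
  by have [] := covB t.
have -> : [set: T * nat] = [set: T] `*`` (fun=> [set: nat]).
  by apply/seteqP; split.
rewrite -(@esum_esum _ _ _ _ _
  (fun t j => (\prod_i ((B t).2 j i - (B t).1 j i))%:E)) //.
apply: (@le_trans _ _ (\esum_(t in [set: T]) (e t)%:E)%E).
  apply: le_esum => t _; rewrite -nneseries_esumT //.
  by have [] := covB t.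
apply: le_trans (@epsilon_trick0 _ eps xpredT (ltW eps_gt0)).
rewrite nneseries_esumT => [|j]; last by rewrite lee_fin divr_ge0 // ltW.
rewrite -[X in (X <= _)%E](esum_image _ _
    (fun j => (eps / (2 ^ j.+1)%:R)%:E)); last first.
  by move=> s t _ _; apply: (pcan_inj pickleK).
rewrite esum_mkcond; apply: le_esum => j _; case: ifP => // _.
by rewrite lee_fin divr_ge0 // ltW.
Qed.
End NullSets.

(** * Locally Lipschitz maps between finite-dimensional spaces *)

Section CoordinateNorm.
Variables (R : realType) (V : vectType R).
Implicit Types v w : V.

(** The l1 norm of the coordinates. As all norms are equivalent, which one is
    chosen is immaterial; the l1 norm makes the bounds below sums over a basis. *)
Definition nrm v : R := \sum_i `|v2r v 0 i|.

Lemma nrm_ge0 v : 0 <= nrm v.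
Proof. by apply: sumr_ge0. Qed.

Lemma le_nrm v i : `|v2r v 0 i| <= nrm v.
Proof. by rewrite /nrm (bigD1 i) //= lerDl sumr_ge0. Qed.

Lemma nrmD v w : nrm (v + w) <= nrm v + nrm w.
Proof.
by rewrite /nrm -big_split ler_sum //= => i _; rewrite linearD mxE ler_normD.
Qed.

Lemma nrmZ a v : nrm (a *: v) = `|a| * nrm v.
Proof.
by rewrite /nrm mulr_sumr; apply: eq_bigr => i _; rewrite linearZ mxE normrM.
Qed.

Lemma nrm0 : nrm 0 = 0.
Proof. by rewrite -(scale0r (0 : V)) nrmZ normr0 mul0r. Qed.

Lemma nrm_sum I (r : seq I) (P : pred I) (F : I -> V) :
  nrm (\sum_(i <- r | P i) F i) <= \sum_(i <- r | P i) nrm (F i).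
Proof.
elim/big_rec2: _ => [|i x v _ le_vx]; first by rewrite nrm0.
by rewrite (le_trans (nrmD _ _)) // lerD2l.
Qed.

Lemma v2r_expand v : v = \sum_i v2r v 0 i *: r2v (delta_mx 0 i).
Proof.
rewrite -[LHS]v2rK {1}[v2r v]row_sum_delta linear_sum.
by under eq_bigr do rewrite linearZ.
Qed.

Lemma scalar_bound (f : V -> R) : scalar f ->
  exists2 K, 0 <= K & forall v, `|f v| <= K * nrm v.
Proof.
move=> lf; have [g gE] : exists g : {scalar V}, f =1 g.
  pose g : {scalar V} := HB.pack f (GRing.isLinear.Build R V R _ f lf).
  by exists g.
exists (\sum_i `|g (r2v (delta_mx 0 i))|) => [|v]; first exact: sumr_ge0.
rewrite gE {1}[v]v2r_expand linear_sum mulrC /nrm mulr_suml.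
apply: le_trans (ler_norm_sum _ _ _) _; apply: ler_sum => i _.
rewrite scalarZ normrM ler_wpM2l //.
by rewrite (bigD1 i) //= lerDl sumr_ge0.
Qed.

End CoordinateNorm.

Section LinearBounds.
Variable R : realType.

Lemma linear_bound (V W : vectType R) (f : {linear V -> W}) :
  exists2 K, 0 <= K & forall v, nrm (f v) <= K * nrm v.
Proof.
exists (\sum_i nrm (f (r2v (delta_mx 0 i)))) => [|v].
  by apply: sumr_ge0 => i _; apply: nrm_ge0.
rewrite {1}[v]v2r_expand linear_sum /= mulrC /nrm mulr_suml.
apply: le_trans (nrm_sum _ _ _) _; apply: ler_sum => i _.
rewrite linearZ nrmZ ler_wpM2l //.
by rewrite (bigD1 i) //= lerDl sumr_ge0 // => j _; apply: nrm_ge0.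
Qed.

Lemma mulmx_bound m n p : exists2 K, 0 <= K &
  forall (A : 'M[R]_(m, n)) (B : 'M[R]_(n, p)), nrm (A *m B) <= K * nrm A * nrm B.
Proof.
pose e i : 'M[R]_(m, n) := r2v (delta_mx 0 i).
have /choice[K K_bound] i : exists K,
    0 <= K /\ forall B : 'M[R]_(n, p), nrm (e i *m B) <= K * nrm B.
  by have [K ? ?] := linear_bound (@mulmx _ m n p (e i)); exists K.
have K_ge0 i : 0 <= K i by have [] := K_bound i.
exists (\sum_i K i) => [|A B]; first exact: sumr_ge0.
rewrite [leRHS](_ : _ = nrm A * ((\sum_i K i) * nrm B)); last by ring.
rewrite {1}[A]v2r_expand mulmx_suml [X in _ <= X * _]/nrm mulr_suml.
apply: le_trans (nrm_sum _ _ _) _; apply: ler_sum => i _.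
rewrite -scalemxAl nrmZ ler_wpM2l // (le_trans (proj2 (K_bound i) B)) //.
rewrite ler_wpM2r ?nrm_ge0 //.
by rewrite (bigD1 i) //= lerDl sumr_ge0.
Qed.

End LinearBounds.

Section LocallyLipschitz.
Variables (R : realType) (W : vectType R).

(** Lipschitz on bounded sets rather than near each point: the two agree in finite
    dimension, and this form is stable under products without any compactness
    argument. *)
Definition loclip (V : vectType R) (f : W -> V) : Prop :=
  forall N : R, exists2 L, 0 <= L & forall x y,
    nrm x <= N -> nrm y <= N -> nrm (f x - f y) <= L * nrm (x - y).

Lemma loclip_linear (V : vectType R) (f : {linear W -> V}) : loclip f.
Proof.
move=> N; have [K K_ge0 fK] := linear_bound f.
by exists K => // x y _ _; rewrite -linearB.
Qed.

Lemma loclip_cst (V : vectType R) (v : V) : loclip (fun=> v).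
Proof. by move=> N; exists 0 => // x y _ _; rewrite subrr nrm0 mul0r. Qed.

Lemma loclipD (V : vectType R) (f g : W -> V) :
  loclip f -> loclip g -> loclip (fun x => f x + g x).
Proof.
move=> lf lg N; have [K K_ge0 fK] := lf N; have [L L_ge0 gL] := lg N.
exists (K + L) => [|x y xN yN]; first exact: addr_ge0.
rewrite opprD addrACA (le_trans (nrmD _ _)) // mulrDl.
by apply: lerD; [exact: fK | exact: gL].
Qed.

Lemma loclip_bounded (V : vectType R) (f : W -> V) : loclip f ->
  forall N, exists2 B, 0 <= B & forall x, nrm x <= N -> nrm (f x) <= B.
Proof.
move=> lf N; have [L L_ge0 fL] := lf N.
exists (L * `|N| + nrm (f 0)) => [|x xN].
  by rewrite addr_ge0 ?mulr_ge0 ?nrm_ge0.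
have N_ge0 : 0 <= N := le_trans (nrm_ge0 x) xN.
rewrite -[f x](subrK (f 0)) (le_trans (nrmD _ _)) // lerD2r.
apply: le_trans (fL _ _ xN _) _; first by rewrite nrm0.
by rewrite subr0 ler_wpM2l // (ger0_norm N_ge0).
Qed.

Lemma loclip_mulmx m n p (f : W -> 'M[R]_(m, n)) (g : W -> 'M[R]_(n, p)) :
  loclip f -> loclip g -> loclip (fun x => f x *m g x).
Proof.
move=> lf lg N; have [K K_ge0 fK] := lf N; have [L L_ge0 gL] := lg N.
have [F F_ge0 fF] := loclip_bounded lf N; have [G G_ge0 gG] := loclip_bounded lg N.
have [B B_ge0 mulB] := mulmx_bound R m n p.
exists (B * K * G + B * F * L) => [|x y xN yN].
  by rewrite addr_ge0 ?mulr_ge0.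
have -> : f x *m g x - f y *m g y = (f x - f y) *m g x + f y *m (g x - g y).
  by rewrite mulmxBl mulmxBr addrA subrK.
apply: le_trans (nrmD _ _) _; rewrite mulrDl; apply: lerD.
  apply: le_trans (mulB _ _) _; rewrite -!mulrA ler_wpM2l // mulrA mulrAC.
  by rewrite ler_pM ?nrm_ge0 ?gG ?fK // mulr_ge0 ?nrm_ge0.
apply: le_trans (mulB _ _) _; rewrite -!mulrA ler_wpM2l //.
by rewrite ler_pM ?nrm_ge0 ?fF ?gL.
Qed.

End LocallyLipschitz.

Lemma loclip_comp (R : realType) (U V W : vectType R) (g : V -> W) (f : U -> V) :
  loclip g -> loclip f -> loclip (fun x => g (f x)).
Proof.
move=> lg lf N; have [B _ fB] := loclip_bounded lf N.
have [K K_ge0 fK] := lf N; have [L L_ge0 gL] := lg B.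
exists (L * K) => [|x y xN yN]; first exact: mulr_ge0.
by rewrite (le_trans (gL _ _ (fB _ xN) (fB _ yN))) // -mulrA ler_wpM2l ?fK.
Qed.

Lemma loclip_linear_comp (R : realType) (U V W : vectType R)
    (g : {linear V -> W}) (f : U -> V) :
  loclip f -> loclip (fun x => g (f x)).
Proof. exact/loclip_comp/loclip_linear. Qed.

(** * Images from a space of smaller dimension *)

Section NullImage.
Local Open Scope classical_set_scope.

Lemma esum_cst_fin (R : realType) (T : finType) (a : R) : 0 <= a ->
  (\esum_(t in [set: T]) a%:E = (a *+ #|T|)%:E)%E.
Proof.
move=> a_ge0; have finT : finite_set [set: T] by exact: finite_finset.
rewrite -[X in esum X](set_mem_set [set: T]) esum_fset // set_mem_set.
rewrite fsbig_finite //= sumEFin (perm_big (index_enum T)) /= ?sumr_const //.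
apply: uniq_perm; rewrite ?finmap.fset_uniq ?index_enum_uniq // => t.
by rewrite in_fset_set // mem_index_enum mem_set.
Qed.

(** Sard's theorem in the easy case where the source has smaller dimension; only
    counting of small cubes is needed. *)
Lemma lebesgue_null_image (R : realType) (W : vectType R) (V : euclideanType R)
    (f : W -> V) :
  loclip f -> (dim W < dim V)%N -> lebesgue_null (range f).
Proof.
move=> lf dimWV; have dimV : (0 < dim V)%N by apply: leq_ltn_trans dimWV.
set D := \dim {:V}.
have dD : (dim W < D)%N by rewrite /D dimvf.
apply: (@lebesgue_null_sub _ _ _
    (\bigcup_(N : nat) (f @` [set x | nrm x <= N%:R]))) => [_ [x _ <-]|].
  exists (Num.truncn (nrm x)).+1 => //; exists x => //=.
  by case/andP: (truncn_itv (nrm_ge0 x)) => _ /ltW.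
apply: lebesgue_null_bigcup => // N; apply: lebesgue_null_cover => // eps eps_gt0.
(* The grid points may leave the ball of radius [N], but their
   coordinates stay in [-N, N]; the Lipschitz constant is taken on a ball that
   contains both. *)
have [L L_ge0 fL] := lf ((dim W)%:R * N%:R + N%:R).
have /choice[K K_bound] (i : 'I_D) : exists K,
    0 <= K /\ forall v, `|coord (vbasis {:V}) i v| <= K * nrm v.
  have [|K ? ?] := @scalar_bound R V (coord (vbasis {:V}) i); last by exists K.
  exact: coord_is_scalar.
have K_ge0 i : 0 <= K i by have [] := K_bound i.
pose c := 2 * (\sum_i K i) * L * (dim W)%:R.
have c_ge0 : 0 <= c by rewrite !mulr_ge0 // sumr_ge0.
pose C := (2 * N + 1)%:R ^+ dim W * c ^+ D.
have C_ge0 : 0 <= C by rewrite mulr_ge0 ?exprn_ge0.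
pose M := (Num.truncn (C / eps)).+1.
have M_gt0 : 0 < M%:R :> R by rewrite ltr0n.
have CM : C / M%:R <= eps.
  rewrite ler_pdivrMr // mulrC -ler_pdivrMr //.
  have : 0 <= C / eps by rewrite divr_ge0 // ltW.
  by move/truncn_itv/andP => [_ /ltW].
(* A grid of step [1 / M] in the cube of half side [N]; [r] bounds the coordinates
   of [f x - f (g j)] when [g j] is the grid point just below [x]. *)
pose g (j : {ffun 'I_(dim W) -> 'I_(2 * N * M).+1}) : W :=
  @r2v _ W (\row_i ((j i)%:R / M%:R - N%:R)).
pose r := c / M%:R / 2.
have r_ge0 : 0 <= r by rewrite !divr_ge0.
exists {ffun 'I_(dim W) -> 'I_(2 * N * M).+1},
  (fun j i => coord (vbasis {:V}) i (f (g j)) - r),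
  (fun j i => coord (vbasis {:V}) i (f (g j)) + r).
split=> [j i|_ [x xN <-]|]; first by rewrite lerD2l ge0_cp.
  have xi i : `|v2r x 0 i| <= N%:R := le_trans (le_nrm x i) xN.
  have itv i : (v2r x 0 i + N%:R) * M%:R < (2 * N * M).+1%:R /\
               0 <= (v2r x 0 i + N%:R) * M%:R.
    move: (xi i); rewrite ler_norml => /andP[x1 x2]; split.
      rewrite -natr1 natrM natrM ltr_pwDr // ler_wpM2r //; lra.
    by rewrite mulr_ge0 //; lra.
  have t_lt (i : 'I_(dim W)) :
      (Num.truncn ((v2r x 0 i + N%:R) * M%:R)%R < (2 * N * M).+1)%N.
    by rewrite truncn_lt_nat; case: (itv i).
  pose j := [ffun i => Ordinal (t_lt i)].
  have near (i : 'I_(dim W)) : `|v2r x 0 i - v2r (g j) 0 i| <= M%:R^-1.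
    rewrite /g r2vK mxE ffunE /=.
    have [_ /truncn_itv/andP[]] := itv i; set t := Num.truncn _ => t1 t2.
    have {}t1 : t%:R / M%:R <= v2r x 0 i + N%:R by rewrite ler_pdivrMr.
    have {}t2 : v2r x 0 i + N%:R < t%:R / M%:R + M%:R^-1.
      by rewrite -{2}[M%:R^-1]mul1r -mulrDl natr1 ltr_pdivlMr.
    by rewrite ger0_norm; lra.
  have gN : nrm (g j) <= (dim W)%:R * N%:R + N%:R.
    rewrite -[leLHS]addr0 lerD //.
    rewrite /nrm mulr_natl -[in leRHS](card_ord (dim W)) -sumr_const.
    apply: ler_sum => i _.
    rewrite /g r2vK mxE ler_norml.
    have : (j i)%:R / M%:R <= 2 * N%:R :> R.
      by rewrite ler_pdivrMr // -!natrM ler_nat -ltnS ltn_ord.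
    have : 0 <= (j i)%:R / M%:R :> R by rewrite divr_ge0.
    by move=> ? ?; lra.
  have xg : nrm (x - g j) <= (dim W)%:R / M%:R.
    rewrite /nrm mulr_natl -[in leRHS](card_ord (dim W)) -sumr_const.
    apply: ler_sum => i _.
    by rewrite linearB !mxE; apply: near.
  exists j => // i /=; rewrite -ler_distl -linearB.
  apply: le_trans (proj2 (K_bound i) _) _.
  have xN' : nrm x <= (dim W)%:R * N%:R + N%:R.
    by rewrite (le_trans xN) // lerDr mulr_ge0.
  have -> : r = (\sum_i K i) * (L * ((dim W)%:R / M%:R)).
    by rewrite /r /c; field; rewrite gt_eqF.
  rewrite ler_pM ?nrm_ge0 //; last first.
    by rewrite (le_trans (fL _ _ xN' gN)) // ler_wpM2l.
  by rewrite (bigD1 i) //= lerDl sumr_ge0.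
rewrite (eq_esum (b := fun=> ((c / M%:R) ^+ D)%:E)) => [|j _]; last first.
  congr (_%:E); rewrite -[D in RHS]card_ord -prodr_const; apply: eq_bigr => i _.
  by rewrite /r; field; rewrite gt_eqF.
(* There are [(2 N M + 1)^(dim W) <= ((2 N + 1) M)^(dim W)] boxes of volume
   [(c / M)^D], and [dim W < D] leaves a factor [1 / M]. *)
rewrite esum_cst_fin ?exprn_ge0 ?divr_ge0 // lee_fin.
rewrite card_ffun !card_ord -[leLHS]mulr_natr natrX.
apply: le_trans CM; rewrite expr_div_n.
have M_ge1 : 1 <= M%:R :> R by rewrite ler1n.
apply: (@le_trans _ _ (c ^+ D / M%:R ^+ D * ((2 * N + 1)%:R * M%:R) ^+ dim W)).
  rewrite ler_wpM2l ?divr_ge0 ?exprn_ge0 // lerXn2r ?nnegrE ?mulr_ge0 //.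
  by rewrite -natrM ler_nat mulnDl mul1n -addn1 leq_add2l.
rewrite [_ ^+ dim W]exprMn mulrACA (mulrC (c ^+ D)) (mulrC _^-1) -/C.
rewrite ler_wpM2l // ler_pdivrMr ?exprn_gt0 // mulrC ler_pdivlMr // -exprSr.
by rewrite ler_weXn2l.
Qed.
End NullImage.

(** * Positive semidefinite matrices *)

Section PsdForms.
Variable R : realType.

Lemma inner_deltal n (x : 'cV[R]_n) i : '[delta_mx i 0, x] = x i 0.
Proof.
rewrite /inner /= /mxinner trmx_delta -rowE /mxtrace big_ord_recl big_ord0 addr0.
by rewrite !mxE.
Qed.

Lemma inner_mulmxl m n p (A : 'M[R]_(m, n)) (x : 'M[R]_(n, p)) (y : 'M[R]_(m, p)) :
  '[A *m x, y] = '[x, A^T *m y].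
Proof. by rewrite /inner /= /mxinner trmx_mul mulmxA. Qed.

Lemma inner_gram_ge0 n k (F : 'M[R]_(n, k)) (x : 'cV[R]_n) :
  0 <= '[x, (F *m F^T) *m x].
Proof.
rewrite -mulmxA -{1}[F]trmxK -inner_mulmxl.
by have [->|/inner_gt0/ltW//] := eqVneq (F^T *m x) 0; rewrite inner0l.
Qed.

Lemma inner_rank1 n (x y : 'cV[R]_n) : '[x, (y *m y^T) *m x] = '[y, x] ^+ 2.
Proof.
rewrite -mulmxA -{1}[y]trmxK -inner_mulmxl /inner /= /mxinner.
set z := y^T *m x; rewrite (mx11_scalar z) tr_scalar_mx -scalar_mxM.
by rewrite !mxtrace_scalar !mulr1n expr2.
Qed.

Lemma quad_expand n (Y : 'M[R]_n) (x y : 'cV[R]_n) (t : R) : Y^T = Y ->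
  '[x + t *: y, Y *m (x + t *: y)] =
  '[x, Y *m x] + 2 * t * '[y, Y *m x] + t ^+ 2 * '[y, Y *m y].
Proof.
move=> symY; rewrite mulmxDr -scalemxAr [_ + t *: (Y *m y)]addrC !innerPr.
rewrite !innerDl !innerZl [in '[x, Y *m y]]innerC inner_mulmxl symY.
by ring.
Qed.

(** An induction in the style of Cholesky factorization: if [a = Y i i] is nonzero
    and [y] is the [i]th column of [Y], then [Y - a^-1 y y^T] is again positive
    semidefinite (Schur complement) and has fewer nonzero diagonal entries,
    while [<S, y y^T> = y^T S y >= 0]. *)
Lemma psd_inner_ge0 n (S Y : 'M[R]_n) : Y^T = Y ->
  (forall x : 'cV_n, 0 <= '[x, S *m x]) ->
  (forall x : 'cV_n, 0 <= '[x, Y *m x]) -> 0 <= '[S, Y].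
Proof.
move=> symY psdS; have [N] := ubnP #|[set i | Y i i != 0]|.
elim: N Y symY => // N IH Y symY ltN psdY.
pose e i : 'cV[R]_n := delta_mx i 0.
have quad i x : '[e i, Y *m x] = (Y *m x) i 0 by exact: inner_deltal.
have quade i j : '[e i, Y *m e j] = Y i j by rewrite quad -colE mxE.
have [i|diag0] := pickP [pred i | Y i i != 0]; last first.
  suff -> : Y = 0 by rewrite innerC inner0l.
  apply/matrixP => i j; rewrite mxE.
  have diag k : Y k k = 0 by apply/eqP; have := diag0 k; rewrite /= => /negbFE.
  (* A zero diagonal forces [Y = 0]: the form at [e_i + t e_j] is [2 t Y_ij], and
     [t = - Y_ij] makes it negative unless
     [Y_ij = 0]. *)
  have := psdY (e i + (- Y j i) *: e j); rewrite quad_expand // !quade !diag.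
  have <- : Y j i = Y i j by rewrite -[in RHS]symY mxE.
  move=> h; apply/eqP; rewrite -sqrf_eq0 eq_le sqr_ge0 andbT; lra.
rewrite /= => Yii; have a_gt0 : 0 < Y i i by rewrite lt_def Yii -quade psdY.
set a := Y i i in Yii a_gt0; pose y := Y *m e i.
pose Y' := Y - a^-1 *: (y *m y^T).
have Y'x x : '[x, Y' *m x] = '[x, Y *m x] - a^-1 * '[y, x] ^+ 2.
  rewrite /Y' mulmxBl -scalemxAl -scaleNr addrC innerPr addrC mulNr.
  by rewrite inner_rank1.
have psdY' (x : 'cV_n) : 0 <= '[x, Y' *m x].
  (* The value at [x] of the new form is the minimum over [t] of the old one on the
     line [x + t e_i]. *)
  have := psdY (x + (- ('[y, x] / a)) *: e i); rewrite quad_expand // quade -/a.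
  have -> : '[e i, Y *m x] = '[y, x] by rewrite /y inner_mulmxl symY.
  rewrite Y'x => h; apply: le_trans h _; rewrite le_eqVlt; apply/orP; left.
  by apply/eqP; field.
have symY' : Y'^T = Y'.
  by rewrite /Y' linearB linearZ /= trmx_mul trmxK symY.
have Y'E j : Y' j j = Y j j - a^-1 * y j 0 ^+ 2.
  by rewrite !mxE big_ord_recl big_ord0 addr0 !mxE expr2.
have yi : y i 0 = a by rewrite /y -colE mxE.
have psd_diag j : 0 <= Y' j j.
  by have := psdY' (e j); rewrite inner_deltal -colE mxE.
have YE : Y = a^-1 *: (y *m y^T) + Y' by rewrite addrC subrK.
have -> : '[S, Y] = a^-1 * '[y, S *m y] + '[S, Y'].
  rewrite [in LHS]YE innerPr; congr (_ * _ + _); rewrite innerC /inner /=.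
  by rewrite /mxinner trmx_mul trmxK -mulmxA mxtrace_mulC mulmxA.
apply: addr_ge0; first by rewrite mulr_ge0 ?psdS // invr_ge0 ltW.
apply: IH => //; rewrite -ltnS (leq_trans _ ltN) // ltnS proper_card //.
apply/properP; split; last first.
  exists i; rewrite !inE ?Yii // Y'E yi negbK subr_eq0 -/a.
  by apply/eqP; field.
apply/fintype.subsetP => j; rewrite !inE; apply: contraNneq => Yjj.
rewrite eq_le psd_diag andbT Y'E Yjj sub0r oppr_le0.
by rewrite mulr_ge0 ?sqr_ge0 ?invr_ge0 // ltW.
Qed.
End PsdForms.

(** * From second-order criticality to global optimality *)

Section Optimality.
Variables (R : realType) (q m : nat) (n : 'I_q -> nat).
Variables (A : forall c, 'Hom('Sym[R]_(n c), 'cV[R]_m)) (b : 'cV[R]_m).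
Variable k : 'I_q -> nat.
Implicit Types (C : symspace R n) (F : factor_space R n k).

Lemma psd_gram F c : psd (gram F c).
Proof. by move=> x; rewrite /gram gram_sym inner_gram_ge0. Qed.

(** Weak duality: the multiplier is a dual certificate as soon as its slack is
    positive semidefinite. *)
Lemma psd_slack_optimal C F :
  second_order_critical A b C F -> (forall c, psd (slack A C F c)) ->
  sdp_optimal A b C (gram F).
Proof.
move=> [/= /eqP feasF critF _] psdS.
have {}feasF : \sum_c A c (gram F c) = b by apply/eqP; rewrite -subr_eq0.
split=> [|Y [psdY feasY]]; first by split=> // c; apply: psd_gram.
have objE (X : symspace R n) : \sum_c A c (X c) = b ->
    \sum_c '[C c, X c] = \sum_c '[slack A C F c, X c] + '[b, multiplier A C F].
  move=> <-; rewrite inner_suml -big_split; apply: eq_bigr => c _ /=.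
  by rewrite adjointP [X in _ + X]innerC -innerDl subrK.
rewrite (objE _ feasF) (objE _ feasY) lerD2r.
have -> : \sum_c '[slack A C F c, gram F c] = 0.
  apply: big1 => c _; rewrite {1}/inner /= /subinner gram_sym innerC.
  rewrite /inner /= /mxinner trmx_mul trmxK -mulmxA mxtrace_mulC -mulmxA.
  by rewrite critF mulmx0 mxtrace0.
apply: sumr_ge0 => c _; apply: psd_inner_ge0; [|exact: psdS|exact: psdY].
by apply/eqP; rewrite -symvE subvsP.
Qed.

(** With [F_c z = 0], the direction [U_c = x z^T] satisfies
    [F_c U_c^T = F_c z x^T = 0], so it is tangent whatever [x] is, and the
    second-order form on it is [|z|^2 (x^T S_c x)]. *)
Lemma rank_deficient_psd_slack C F c :
  second_order_critical A b C F -> (\rank (F c) < k c)%N -> psd (slack A C F c).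
Proof.
move=> [_ _ socF] rankF x.
have [z z_neq0 Fz] : exists2 z : 'cV_(k c), z != 0 & F c *m z = 0.
  have : kermx (F c)^T != 0.
    by rewrite kermx_eq0 /row_free mxrank_tr neq_ltn rankF.
  case/rowV0Pn => v /sub_kermxP vF v_neq0; exists v^T; first by rewrite trmx_eq0.
  by rewrite -[F c]trmxK -trmx_mul vF trmx0.
pose U : factor_space R n k :=
  @eqtype.dfwith _ (fun c => 'M[R]_(n c, k c)) (fun=> 0) c (x *m z^T).
have := socF U; rewrite dconstrE big1 => [/(_ erefl)|c' _]; last first.
  rewrite /U; case: eqtype.dfwithP => [|c'' _].
    rewrite trmx_mul trmxK mulmxA Fz mul0mx add0r.
    by rewrite -mulmxA -trmx_mul Fz trmx0 mulmx0 /tosym !linear0.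
  by rewrite trmx0 mulmx0 mul0mx addr0 /tosym !linear0.
rewrite (bigD1 c) //= big1 ?addr0 /U ?eqtype.dfwith_in => [|c' c'_neq]; last first.
  by rewrite eqtype.dfwith_out 1?eq_sym // mulmx0 inner0l.
rewrite /inner /= /mxinner trmx_mul trmxK -mulmxA mxtrace_mulC -!mulmxA.
rewrite [z^T *m z]mx11_scalar !mul_mx_scalar !linearZ /= pmulr_rge0 //.
have : 0 < \tr (z^T *m z) by exact: inner_gt0 _ z_neq0.
by rewrite {1}[z^T *m z]mx11_scalar mxtrace_scalar mulr1n.
Qed.

(** Either [F_c] has a kernel, or it is square and invertible, and then
    [S_c F_c = 0] gives [S_c = 0]. *)
Lemma wide_psd_slack C F c :
  second_order_critical A b C F -> (n c <= k c)%N -> psd (slack A C F c).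
Proof.
move=> critF le_nk; have [rankF|] := ltnP (\rank (F c)) (k c).
  exact: rank_deficient_psd_slack.
move=> le_k; have freeF : row_free (F c).
  by rewrite /row_free eqn_leq rank_leq_row (leq_trans le_nk).
suff S0 : vsval (slack A C F c) = 0.
  by move=> x; rewrite S0 mul0mx innerC inner0l.
apply: (row_free_inj freeF); rewrite mul0mx.
by case: critF => _ ->.
Qed.

End Optimality.

(** * Dimension of the space of symmetric matrices *)

Section SymmetricDimension.
Variable R : realType.

Lemma leq_dim_inj (V W : vectType R) (f : 'Hom(V, W)) :
  injective f -> (dim V <= dim W)%N.
Proof.
move=> /lker0P kf; rewrite -!dimvf -(limg_dim_eq (f := f) (U := fullv)).
  exact: dimvS (subvf _).
by rewrite (eqP kf) capv0.
Qed.

(** The two diagonal blocks and one off-diagonal block can be chosen freely. This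
    inequality is applied twice: to bound [tau k] by the dimension, and to count
    the parameters of the matrices of low rank. *)
Lemma dim_sym_block a b :
  (dim 'Sym[R]_a + dim 'Sym[R]_b + a * b <= dim 'Sym[R]_(a + b))%N.
Proof.
pose f (p : 'Sym[R]_a * 'Sym[R]_b * 'M[R]_(a, b)) : 'Sym[R]_(a + b) :=
  tosym (block_mx (vsval p.1.1) p.2 p.2^T (vsval p.1.2)).
have valf p : vsval (f p) = block_mx (vsval p.1.1) p.2 p.2^T (vsval p.1.2).
  apply: tosymK; rewrite tr_block_mx trmxK.
  by congr block_mx; apply/eqP; rewrite -symvE subvsP.
have lf : linear f.
  move=> t u v; apply: val_inj.
  change (vsval (f (t *: u + v)) = vsval (t *: f u + f v)).
  rewrite [RHS]linearP valf /=.
  apply: etrans (congr2 +%R (congr1 ( *:%R t) (esym (valf u))) (esym (valf v))).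
  by rewrite scale_block_mx add_block_mx linearP.
pose g : {linear _ -> _} := HB.pack f (GRing.isLinear.Build R _ _ _ f lf).
suff inj_g : injective (linfun g) by exact: (leq_dim_inj inj_g).
move=> u v; rewrite !lfunE /= => /(congr1 vsval); rewrite !valf.
case/eq_block_mx => /val_inj e1 e2 _ /val_inj e3.
by move: u v e1 e2 e3 => [[? ?] ?] [[? ?] ?] /= -> -> ->.
Qed.

Lemma tau_le_dim_sym k : (tau k <= dim 'Sym[R]_k)%N.
Proof.
have dim1 : (0 < dim 'Sym[R]_1)%N.
  rewrite -[dim _]/(\dim (symv R 1)) lt0n dimv_eq0.
  apply/eqP => symv0; have : 1%:M \in symv R 1 by rewrite symvE trmx1.
  by rewrite symv0 memv0 oner_eq0.
elim: k => // k IH; rewrite -addn1; apply: leq_trans (dim_sym_block k 1).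
have -> : tau (k + 1) = (tau k + 1 + k * 1)%N.
  rewrite /tau; have := odd_double_half (k * k.+1); have := oddM k k.+1; lia.
by rewrite leq_add2r leq_add.
Qed.

End SymmetricDimension.

(** * Symmetric matrices that kill a matrix of given rank *)

Section LowRankSymmetric.
Variable R : realType.

Lemma inj_perm_lshift k p (f : 'I_k -> 'I_(k + p)) : injective f ->
  exists s : 'S_(k + p), forall i, s (lshift p i) = f i.
Proof.
move=> inj_f; pose r := codom f ++ [seq j <- enum 'I_(k + p) | j \notin codom f].
have uniq_r : uniq r.
  rewrite cat_uniq filter_uniq ?enum_uniq // andbT.
  rewrite map_inj_uniq ?enum_uniq //=; apply/hasPn => j.
  by rewrite mem_filter => /andP[].
have mem_r j : j \in r.
  by rewrite mem_cat mem_filter mem_enum andbT orbN.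
have size_r : size r = (k + p)%N.
  rewrite -[RHS]card_ord -(card_uniqP uniq_r).
  by apply: eq_card => j; rewrite mem_r.
have inj_r : injective (fun i : 'I_(k + p) => nth i r i).
  move=> i j; rewrite (set_nth_default i) ?size_r // => /eqP.
  by rewrite nth_uniq ?size_r // => /eqP/val_inj.
exists (perm inj_r) => i; rewrite permE /= nth_cat size_codom card_ord ltn_ord.
by rewrite (nth_map i) ?size_enum_ord // nth_ord_enum.
Qed.

Lemma full_rank_perm k p (F : 'M[R]_(k + p, k)) : \rank F = k ->
  exists s : 'S_(k + p), usubmx (row_perm s F) \in unitmx.
Proof.
move=> rankF; have fullF : row_full F by rewrite /row_full rankF.
have [|s sE] := @inj_perm_lshift k p (fullrankfun fullF).
  exact: fullrankfun_inj.
exists s; suff -> : usubmx (row_perm s F) = rowsub (fullrankfun fullF) F.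
  exact: fullrowsub_unit.
by apply/matrixP => i j; rewrite !mxE sE.
Qed.

(** When the top block of [F] is invertible, the kernel condition expresses the
    left blocks of [S] through the right ones, and symmetry leaves [drsubmx S]
    and [Z] as the only parameters. *)
Lemma sym_kernel_block k p (S : 'M[R]_(k + p)) (F : 'M[R]_(k + p, k)) :
  S^T = S -> usubmx F \in unitmx -> S *m F = 0 ->
  let Z := - (dsubmx F *m invmx (usubmx F)) in
  S = (row_mx Z 1%:M)^T *m drsubmx S *m row_mx Z 1%:M.
Proof.
move=> symS unitF SF Z; set d := drsubmx S.
have symd : d^T = d by rewrite /d trmx_drsub symS.
have [SuF SdF] : ulsubmx S *m usubmx F + ursubmx S *m dsubmx F = 0 /\
    dlsubmx S *m usubmx F + d *m dsubmx F = 0.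
  move: SF; rewrite -{1}[S]submxK -{1}[F]vsubmxK mul_block_col -col_mx0.
  by case/eq_col_mx.
have solve j (a : 'M[R]_(j, k)) (c : 'M[R]_(j, p)) :
    a *m usubmx F + c *m dsubmx F = 0 -> a = c *m Z.
  move=> /eqP; rewrite addr_eq0 => /eqP acF.
  by rewrite -[a](mulmxK unitF) acF mulNmx /Z mulmxN mulmxA.
have dlE := solve _ _ _ SdF; have urE : ursubmx S = Z^T *m d.
  by rewrite -[LHS]trmxK trmx_ursub symS dlE trmx_mul symd.
rewrite -{1}[S]submxK (solve _ _ _ SuF) dlE urE -/d.
by rewrite tr_row_mx trmx1 mul_col_mx mul1mx mul_col_row !mulmx1.
Qed.

(** [f f^+] is the orthogonal projection on the image of [f], and
    [f^* = (f f^+ f)^* = f^* f f^+]. Hence [f^*] needs no more parameters than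
    the rank of [f]. *)
Lemma adjoint_limg (V W : euclideanType R) (f : 'Hom(V, W)) w :
  exists2 y, y \in limg f & adjoint f w = adjoint f y.
Proof.
have [fpf _ fp_adj _] := pinvlfP f.
exists (f (pinvlf f w)); first by rewrite memv_img ?memvf.
by rewrite -{1}fpf adjoint_comp fp_adj !comp_lfunE.
Qed.

(** The index [t] is a permutation that brings an invertible block of [F] to the
    top. The number of parameters is
    [dim Sym (n - k) + (n - k) k + rank A < dim Sym (n - k) + (n - k) k + tau k],
    at most [dim Sym n]. *)
Lemma low_rank_param m n k (A : 'Hom('Sym[R]_n, 'cV[R]_m)) :
  (k <= n)%N -> (\dim (limg A) < tau k)%N ->
  exists (T : countType) (W : vectType R) (f : T -> W -> 'Sym[R]_n),
    [/\ forall t, loclip (f t), (dim W < dim 'Sym[R]_n)%N &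
        forall (S : 'Sym[R]_n) (F : 'M[R]_(n, k)) nu,
          \rank F = k -> vsval S *m F = 0 ->
          exists t w, f t w = S + adjoint A nu].
Proof.
move=> le_kn; rewrite -(subnKC le_kn) in A *; move: (n - k)%N A => p A dimA.
pose W : vectType R := ('Sym[R]_p * 'M[R]_(p, k) * subvs_of (limg A))%type.
pose J (s : 'S_(k + p)) (w : W) : 'M[R]_(p, k + p) :=
  w.1.2 *m usubmx (perm_mx s) + dsubmx (perm_mx s).
pose f s (w : W) : 'Sym[R]_(k + p) :=
  tosym ((J s w)^T *m vsval w.1.1 *m J s w) + adjoint A (vsval w.2).
exists 'S_(k + p), W, f; split=> [s||S F nu rankF SF].
- have lip1 : loclip (fun w : W => w.1) by exact: loclip_linear.
  have lipJ : loclip (J s).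
    apply: loclipD (loclip_cst _ _); apply: loclip_mulmx (loclip_cst _ _).
    exact: loclip_linear_comp lip1.
  apply: loclipD; apply: loclip_linear_comp; last first.
    by apply: loclip_linear_comp; apply: loclip_linear.
  do 2?[apply: loclip_mulmx] => //; apply: loclip_linear_comp => //.
  exact: loclip_linear_comp lip1.
- have : dim W = (dim 'Sym[R]_p + p * k + \dim (limg A))%N by [].
  move=> ->; apply: leq_trans (dim_sym_block R k p).
  have := tau_le_dim_sym R k; lia.
have [s unitF] := full_rank_perm rankF; set P := perm_mx s : 'M[R]_(k + p).
have PTP : P^T *m P = 1%:M.
  by rewrite /P tr_perm_mx -perm_mxM mulVg perm_mx1.
have symS : (vsval S)^T = vsval S by apply/eqP; rewrite -symvE subvsP.
pose S' := P *m vsval S *m P^T.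
have [y ylim nuy] := adjoint_limg A nu.
pose Z := - (dsubmx (row_perm s F) *m invmx (usubmx (row_perm s F))).
exists s, (tosym (drsubmx S'), Z, Subvs ylim); rewrite /f /= -nuy; congr (_ + _).
have symS' : S'^T = S' by rewrite /S' !trmx_mul trmxK symS mulmxA.
have S'F : S' *m row_perm s F = 0.
  by rewrite row_permE /S' -mulmxA (mulmxA P^T) PTP mul1mx -mulmxA SF mulmx0.
have JE w : J s w = row_mx w.1.2 1%:M *m P.
  by rewrite -[P]vsubmxK mul_row_col mul1mx.
have dK : vsval (tosym (drsubmx S')) = drsubmx S'.
  by apply: tosymK; rewrite trmx_drsub symS'.
rewrite JE /= dK.
have -> : (row_mx Z 1%:M *m P)^T *m drsubmx S' *m (row_mx Z 1%:M *m P) = vsval S.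
  rewrite trmx_mul !mulmxA -(mulmxA P^T) -(mulmxA P^T).
  rewrite -(sym_kernel_block symS' unitF S'F) /S' -!mulmxA PTP mulmx1.
  by rewrite mulmxA PTP mul1mx.
by apply: val_inj; apply: tosymK.
Qed.

End LowRankSymmetric.

(** * The exceptional costs *)

Section BlockNull.
Local Open Scope classical_set_scope.
Variables (R : realType) (q : nat) (n : 'I_q -> nat).

(** A cylinder over a null set, kept as the image of one map: the blocks other than
    [c] enter as extra parameters ranging over the kernel of the projection to
    block [c]. This avoids comparing the bases of the sum and of its block. *)
Lemma lebesgue_null_block c (W : vectType R) (f : W -> 'Sym[R]_(n c)) :
  loclip f -> (dim W < dim 'Sym[R]_(n c))%N ->
  lebesgue_null [set C : symspace R n | range f (C c)].
Proof.
move=> lipf dimW.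
pose proj_fun (C : symspace R n) : 'Sym[R]_(n c) := C c.
have proj_lin : linear proj_fun by [].
pose proj : {linear _ -> _} :=
  HB.pack proj_fun (GRing.isLinear.Build R _ _ _ proj_fun proj_lin).
pose inj_fun (X : 'Sym[R]_(n c)) : symspace R n :=
  @eqtype.dfwith _ (fun c => 'Sym[R]_(n c)) (fun=> 0) c X.
have inj_lin : linear inj_fun.
  move=> a X Y; apply: functional_extensionality_dep => c'.
  rewrite dsumDE dsumZE /inj_fun; case: (eqVneq c c') => [<-|neq].
    by rewrite !eqtype.dfwith_in.
  by rewrite !eqtype.dfwith_out // scaler0 addr0.
pose inj : {linear _ -> _} :=
  HB.pack inj_fun (GRing.isLinear.Build R _ _ _ inj_fun inj_lin).
have projK X : proj (inj X) = X by rewrite /= /proj_fun /inj_fun eqtype.dfwith_in.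
pose K := lker (linfun proj).
pose g (p : subvs_of K * W) : symspace R n := vsval p.1 + inj (f p.2).
apply: (@lebesgue_null_sub _ _ _ (range g)) => [C [w _ fw]|].
  have CK : C - inj (C c) \in K.
    by rewrite memv_ker lfunE linearB projK subrr.
  by exists (Subvs CK, w) => //; rewrite /g /= fw subrK.
apply: lebesgue_null_image.
  apply: loclipD; apply: loclip_linear_comp; first exact: loclip_linear.
  by apply: loclip_comp lipf _; apply: loclip_linear.
have -> : dim (subvs_of K * W)%type = (\dim K + dim W)%N by [].
have : (\dim K + \dim (limg (linfun proj)))%N = dim (symspace R n).
  by rewrite -[K]capfv limg_ker_dim dimvf.
have -> : limg (linfun proj) = fullv.
  apply/eqP; rewrite eqEsubv subvf; apply/subvP => X _.
  by rewrite -[X]projK -[proj _]lfunE memv_img ?memvf.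
by rewrite dimvf => <-; rewrite ltn_add2l.
Qed.
End BlockNull.

Theorem theorem1 (R : realType) (q m : nat) (n : 'I_q -> nat)
  (hq : (0 < q)%N) (hm : (0 < m)%N) (hn : forall c, (0 < n c)%N)
  (A : forall c, 'Hom('Sym[R]_(n c), 'cV[R]_m)) (b : 'cV[R]_m)
  (k : 'I_q -> nat) (hk : forall c, (0 < k c)%N)
  (hsmooth : smooth_at A b k)
  (hrank : forall c, (n c <= k c)%N \/ (oprank A c < tau (k c))%N) :
  let all_critical_optimal (C : symspace R n) : Prop :=
    forall F : factor_space R n k,
      second_order_critical A b C F -> sdp_optimal A b C (gram F) in
  almost_every all_critical_optimal /\
  ((forall c, (n c <= k c)%N) -> forall C, all_critical_optimal C).
Proof.
move=> all_critical_optimal; split=> [|wide C F critF]; last first.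
  by apply: psd_slack_optimal => // c; apply: wide_psd_slack critF (wide c).
pose bad (c : 'I_q) := [set C : symspace R n |
  (k c < n c)%N /\ exists (S : 'Sym[R]_(n c)) (F : 'M[R]_(n c, k c)) nu,
    [/\ \rank F = k c, vsval S *m F = 0 & C c = S + adjoint (A c) nu]]%classic.
apply: (@lebesgue_null_sub _ _ _ (\bigcup_c bad c)%classic) => [C|].
  move=> notopt; apply: contra_notP notopt => notbad F critF.
  apply: psd_slack_optimal => // c.
  have [le_nk|lt_kn] := leqP (n c) (k c); first exact: wide_psd_slack critF le_nk.
  have [|le_k] := ltnP (\rank (F c)) (k c).
    exact: rank_deficient_psd_slack critF.
  case: notbad; exists c => //; split=> //.
  exists (slack A C F c), (F c), (multiplier A C F); split.
  - by apply/eqP; rewrite eqn_leq rank_leq_col.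
  - by case: critF => _ ->.
  - by rewrite /slack subrK.
have dimV : (0 < dim (symspace R n))%N.
  have -> : dim (symspace R n) = (\sum_c dim 'Sym[R]_(n c))%N by [].
  rewrite (bigD1 (Ordinal hq)) //= addn_gt0 (leq_trans _ (tau_le_dim_sym R _)) //.
  rewrite /tau half_gt0; have := hn (Ordinal hq); nia.
apply: lebesgue_null_bigcup => // c.
have [le_nk|lt_kn] := leqP (n c) (k c).
  (* The empty set is written as an empty union because its covers, too, must have
     small volume: it would not be null in dimension zero. *)
  have bad0 : (bad c `<=` \bigcup_(t : void) set0)%classic.
    by move=> C [/=]; rewrite ltnNge le_nk.
  by apply: lebesgue_null_sub bad0 _; apply: lebesgue_null_bigcup => // -[].
case: (hrank c) => [|rankA]; first by rewrite leqNgt lt_kn.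
have [T [W [f [lipf dimW coverf]]]] := low_rank_param (ltnW lt_kn) rankA.
apply: (@lebesgue_null_sub _ _ _
    (\bigcup_(t : T) [set C : symspace R n | range (f t) (C c)])%classic).
  move=> C [_ [S [F [nu [rankF SF Cc]]]]].
  have [t [w fw]] := coverf S F nu rankF SF.
  by exists t => //; exists w; rewrite // fw.
by apply: lebesgue_null_bigcup => // t; apply: lebesgue_null_block.
Qed.
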